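(* Let $X$ be a metrizable topological space in which every sequence $(K_n)_{n\in\omega}$ of subsets of $X$ has a convergent subsequence. Then $d(X)<\mathfrak{s}$.
   Context: $d(X)$ denotes the density of $X$, the least cardinality of a dense subset of $X$. A family $\mathcal{S}\subseteq[\omega]^\omega$ of infinite subsets of $\omega$ is a splitting family if for every $A\in[\omega]^\omega$ there is $S\in\mathcal{S}$ such that $A\cap S$ and $A\setminus S$ are both infinite; the splitting number $\mathfrak{s}$ is the smallest cardinality of a splitting family. Convergence is in the sense of Kuratowski: for a sequence $(K_n)_{n\in A}$ of subsets of $X$ indexed by an infinite set $A\subseteq\omega$, $\mathrm{Li}\,(K_n)_{n\in A}$ is the set of all $x\in X$ such that for every neighborhood $U$ of $x$, $U\cap K_n\neq\emptyset$ for all but finitely many $n\in A$; and $\mathrm{Ls}\,(K_n)_{n\in A}$ is the set of all $x\in X$ such that for every neighborhood $U$ of $x$, $U\cap K_n\neq\emptyset$ for infinitely many $n\in A$. The sequence converges if $\mathrm{Li}\,(K_n)_{n\in A}=\mathrm{Ls}\,(K_n)_{n\in A}$ (this common set may be empty). A subsequence of $(K_n)_{n\in\omega}$ is a sequence $(K_n)_{n\in A}$ with $A\subseteq\omega$ infinite. *)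

(* Defs.v *)
From mathcomp Require Import all_boot all_order all_algebra.
From mathcomp Require Import all_classical all_reals.
From mathcomp Require Import topology.

Set Implicit Arguments.
Unset Strict Implicit.
Unset Printing Implicit Defensive.

Import Order.TTheory GRing.Theory Num.Theory.
Local Open Scope classical_set_scope.
Local Open Scope card_scope.
Local Open Scope ring_scope.

Definition is_metric (R : realType) (T : Type) (d : T -> T -> R) : Prop :=
  [/\ forall x y, 0 <= d x y,
      forall x y, d x y = 0 <-> x = y,
      forall x y, d x y = d y x &
      forall x y z, d x z <= d x y + d y z].

Definition metrizable (R : realType) (X : topologicalType) : Prop :=
  exists2 d : X -> X -> R, is_metric d &
    forall (x : X) (A : set X),
      nbhs x A <-> exists2 e : R, 0 < e & [set y | d x y < e] `<=` A.

Definition Li (X : topologicalType) (K : nat -> set X) (A : set nat) : set X :=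
  [set x | forall U, nbhs x U ->
    finite_set [set n | A n /\ ~ (U `&` K n !=set0)]].

Definition Ls (X : topologicalType) (K : nat -> set X) (A : set nat) : set X :=
  [set x | forall U, nbhs x U ->
    infinite_set [set n | A n /\ U `&` K n !=set0]].

Definition kuratowski_cvg (X : topologicalType) (K : nat -> set X)
    (A : set nat) : Prop :=
  Li K A = Ls K A.

Definition card_lt (T U : Type) (A : set T) (B : set U) : bool :=
  (A #<= B) && (A #!= B).

(* There is no type of cardinals: the least cardinality of a set in a family F
   is represented by a set of F attaining it, chosen once and for all.
   The default value set0 is only reached for empty F, see least_cardP. *)
Definition is_least_card (T : Type) (F : set (set T)) (A : set T) : Prop :=
  F A /\ forall B, F B -> A #<= B.

Definition least_card (T : Type) (F : set (set T)) : set T :=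
  xget set0 [set A | is_least_card F A].

Definition density (X : topologicalType) : set X :=
  least_card [set D : set X | dense D].
Arguments density : clear implicits.

Definition splitting_family (S : set (set nat)) : Prop :=
  (forall B, S B -> infinite_set B) /\
  forall A, infinite_set A ->
    exists B, [/\ S B, infinite_set (A `&` B) & infinite_set (A `\` B)].

Definition splitting_number : set (set nat) :=
  least_card [set S | splitting_family S].

(* Take a maximal set C of choice functions on F that pairwise differ at every
   A in F. By maximality some A in F is exhausted by the values of C at A, and
   evaluation at any B in F embeds C into B. *)
Lemma is_least_card_exists (T : Type) (F : set (set T)) :
  F !=set0 -> exists A, is_least_card F A.
Proof.
move=> [A0 FA0].
pose P := [set C : set (set T -> T) |
  (forall g A, C g -> F A -> A (g A)) /\
  (forall g h A, C g -> C h -> F A -> g A = h A -> g = h)].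
have [|C [[CF Cinj] Cmax]] := @Zorn_bigcup _ P.
  move=> G GP Gtot; split=> [g A [C GC Cg] FA|g h A [C GC Cg] [D GD Dh] FA].
    by have [CF _] := GP _ GC; exact: (CF _ _ Cg FA).
  have [CD|DC] := Gtot _ _ GC GD.
    by have [_ Dinj] := GP _ GD; exact: (Dinj _ _ _ (CD _ Cg) Dh FA).
  by have [_ Cinj] := GP _ GC; exact: (Cinj _ _ _ Cg (DC _ Dh) FA).
have [A [FA AC]] : exists A, F A /\ A `<=` [set g A | g in C].
  apply: contrapT => H.
  have ex A : exists t, F A -> A t /\ forall g, C g -> g A <> t.
    have ex' B : F B -> exists t, B t /\ forall g, C g -> g B <> t.
      move=> FB; apply: contrapT => nex; apply: H; exists B; split=> // t Bt.
      apply: contrapT => nt; apply: nex; exists t; split=> // g Cg gt.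
      by apply: nt; exists g.
    have [/ex'[t ?]|nFA] := pselect (F A); first by exists t.
    by have [t _] := ex' _ FA0; exists t.
  have [g0 g0P] := choice ex.
  apply: (Cmax (C `|` [set g0])) => /=.
    split; first exact: subsetUl.
    by move=> /(_ g0 (or_intror erefl)) /((g0P _ FA0).2); exact.
  split=> [g B [Cg|->] FB|g h B [Cg|->] [Ch|->] FB] //.
  - exact: (CF _ _ Cg FB).
  - exact: (g0P _ FB).1.
  - exact: (Cinj _ _ _ Cg Ch FB).
  - by move/((g0P _ FB).2 _ Cg).
  - by move/esym/((g0P _ FB).2 _ Ch).
exists A; split=> // B FB.
apply: card_le_trans (subset_card_le AC) _.
apply: card_le_trans (card_image_le _ _) _.
have injB : {in C &, injective (fun g : set T -> T => g B)}.
  by move=> g h /set_mem Cg /set_mem Ch; exact: (Cinj _ _ _ Cg Ch FB).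
rewrite -(card_le_eql (inj_card_eq injB)); apply: subset_card_le.
by move=> _ [g Cg <-]; exact: (CF _ _ Cg FB).
Qed.

Lemma least_cardP (T : Type) (F : set (set T)) :
  F !=set0 -> is_least_card F (least_card F).
Proof. by move=> /is_least_card_exists[A ?]; exact: (@xgetI _ set0 _ A). Qed.

Lemma densityP (X : topologicalType) :
  is_least_card [set D : set X | dense D] (density X).
Proof.
by apply: least_cardP; exists setT => O O0 _; rewrite setIT.
Qed.

Lemma splitting_family_infinite_sets :
  splitting_family [set B | infinite_set B].
Proof.
split=> // A Ainf.
have /infiniteP/pcard_leP[f] := Ainf.
have finj : injective f by move=> m n; apply: inj; rewrite inE.
have inf_im (h : nat -> nat) : injective h -> infinite_set [set f (h n) | n in setT].
  move=> hinj; apply/infiniteP.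
  rewrite (card_le_eqr (inj_card_eq _))//.
  by move=> m n _ _ /finj/hinj.
have fA n : A (f n) by exact: (@funS _ _ _ _ f).
have inf_even := inf_im _ double_inj.
exists [set f (n.*2) | n in setT]; split=> //.
  by apply: sub_infinite_set inf_even => _ [n _ <-]; split; [exact: fA | exists n].
have oinj : injective (fun n => n.*2.+1) by move=> m n [/double_inj].
apply: sub_infinite_set (inf_im _ oinj) => _ [n _ <-].
split; first exact: fA.
move=> [m _ /finj/(congr1 odd)].
by rewrite /= !odd_double.
Qed.

Lemma splitting_numberP :
  is_least_card [set S | splitting_family S] splitting_number.
Proof.
by apply: least_cardP; eexists; exact: splitting_family_infinite_sets.
Qed.

Lemma metricType_metrizable (R : realType) (X : metricType R) :
  metrizable R X.
Proof.
exists (@mdist R X).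
  split=> [x y|x y|x y|x y z].
  - exact: mdist_ge0.
  - by split=> [/mdist_positivity//|->]; exact: mdistxx.
  - exact: metric_sym.
  - exact: metric_triangle.
move=> x A; rewrite nbhs_ballP /nbhs_ball.
by split=> -[e /= e0 eA]; exists e => //; move: eA; rewrite ballEmdist.
Qed.

(* Main.v *)
Require Import Defs.
From mathcomp Require Import all_boot all_order all_algebra.
From mathcomp Require Import all_classical all_reals.
From mathcomp Require Import topology.
Local Open Scope classical_set_scope.

Import Order.TTheory GRing.Theory Num.Theory.
Local Open Scope ring_scope.

(** If a point [x B] is attached injectively to each [B] in a splitting family
    so that the points [x B] form a discrete set, then the sets
    [K n = {x B | n \in B}] have no convergent subsequence: a set [B] splitting
    the index set [A] puts [x B] in the upper limit but not in the lower one.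
    A metrizable space has a dense subset that is a countable union of discrete
    sets, so if [d(X) >= s], then a splitting family is a countable union of
    families indexing discrete sets of points. By the compactness hypothesis,
    inside every infinite set there is an infinite set not split by any member
    of the n-th family. A pseudo-intersection of a decreasing sequence of such
    sets is not split by any member of the union, a contradiction. This argument
    amounts to [s] having uncountable cofinality. *)

(** A least member of the pair, given by [is_least_card_exists], decides the comparison; the copies
    in [T + U] put both sets in one type. *)
Lemma card_le_total (T U : Type) (A : set T) (B : set U) :
  ~~ (A #<= B)%card -> (B #<= A)%card.
Proof.
pose A' : set (T + U) := inl @` A; pose B' : set (T + U) := inr @` B.
have eA : (A' #= A)%card by apply: inj_card_eq => x y _ _ [].
have eB : (B' #= B)%card by apply: inj_card_eq => x y _ _ [].
rewrite -(card_le_eql eA) -(card_le_eqr eB) -(card_le_eql eB) -(card_le_eqr eA).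
have [|C [CAB Cmin]] := @is_least_card_exists _ [set A'; B'].
  by exists A'; left.
move=> nAB; case: CAB Cmin => -> Cmin; last by apply: Cmin; left.
by move: nAB; rewrite Cmin//; right.
Qed.

Lemma infinite_set_natP (A : set nat) :
  infinite_set A <-> forall n, exists2 m, A m & (n <= m)%N.
Proof.
split=> [Ainf n|Aunb].
  apply: contrapT => nA; apply: Ainf.
  apply: (@sub_finite_set _ _ _ _ (finite_II n)) => m Am /=.
  by rewrite ltnNge; apply/negP => nm; apply: nA; exists m.
move=> /finite_seqP[s As]; have [m] := Aunb (\max_(i <- s) i).+1.
rewrite As ltnNge /= => ms; apply/negP; rewrite negbK.
exact: (leq_bigmax_seq _ ms).
Qed.

Definition unsplit (B A : set nat) : Prop :=
  finite_set (A `&` B) \/ finite_set (A `\` B).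

Lemma unsplit_sub_mod_finite (B A A' : set nat) :
  finite_set (A' `\` A) -> unsplit B A -> unsplit B A'.
Proof.
move=> finA [finB|finB]; [left|right]; have := conj finA finB;
  rewrite -finite_setU; apply: sub_finite_set;
  by move=> n [A'n ?]; have [An|nAn] := pselect (A n); [right|left].
Qed.

Lemma discrete_unsplit (X : topologicalType)
    (cX : forall K : nat -> set X,
       exists2 A : set nat, infinite_set A & kuratowski_cvg K A)
    (I : Type) (P : set I) (x : I -> X) (B : I -> set nat)
    (xdisc : forall i, P i ->
       exists2 U, nbhs (x i) U & forall j, P j -> U (x j) -> j = i)
    (A : set nat) (Ainf : infinite_set A) :
  exists A', [/\ A' `<=` A, infinite_set A' & forall i, P i -> unsplit (B i) A'].
Proof.
have /infiniteP/pcard_leP[e] := Ainf.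
have einj : injective e by move=> m n; apply: inj; rewrite inE.
have eA n : A (e n) by exact: (@funS _ _ _ _ e).
(* Since [cX] takes sequences indexed by all of [nat], [K] follows [A] along [e]; the image under
   [e] of the indices [A0] of a convergent subsequence is the set sought. *)
pose K n : set X := [set x j | j in [set j | P j /\ B j (e n)]].
have [A0 A0inf cvgK] := cX K.
exists (e @` A0); split=> [_ [n _ <-]//||i Pi].
  by move=> efin; apply: A0inf; rewrite -(eq_finite_set (inj_card_eq (in2W einj))).
have [finB|infB] := pselect (finite_set [set n | A0 n /\ B i (e n)]).
  left; apply: (@sub_finite_set _ _ _ _ (finite_image e finB)).
  by move=> _ [[n A0n <-] Bn]; exists n.
right.
have : Ls K A0 (x i).
  move=> V /nbhs_singleton Vx; apply: sub_infinite_set infB => n [A0n Bn].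
  by split=> //; exists (x i); split=> //; exists i.
rewrite -cvgK; have [U Ux Uinj] := xdisc i Pi => /(_ U Ux) /(finite_image e).
apply: sub_finite_set => _ [[n A0n <-] nBn]; exists n => //; split=> //.
(* Among the points [x j] with [P j], only [x i] lies in [U], so [U] meets [K n] only if [e n] is in
   [B i]. *)
move=> [y [Uy [j [Pj Bj] xj]]]; apply: nBn.
by rewrite -(Uinj j Pj)// xj.
Qed.

Lemma countable_union_unsplit (I : Type) (P : nat -> set I) (B : I -> set nat) :
  (forall n A, infinite_set A -> exists A',
     [/\ A' `<=` A, infinite_set A' & forall i, P n i -> unsplit (B i) A']) ->
  exists2 A, infinite_set A & forall n i, P n i -> unsplit (B i) A.
Proof.
move=> H.
have step (nA : nat * set nat) : exists A', infinite_set nA.2 ->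
    [/\ A' `<=` nA.2, infinite_set A' & forall i, P nA.1 i -> unsplit (B i) A'].
  have [/(H nA.1)[A' ?]|nAinf] := pselect (infinite_set nA.2); first by exists A'.
  by exists set0.
have [g gP] := choice step.
pose A := fix A n := if n is m.+1 then g (m, A m) else setT.
have Ainf n : infinite_set (A n).
  elim: n => [|n /(gP (n, _))[]//]; exact: infinite_nat.
have AS n : A n.+1 `<=` A n by have [] := gP (n, A n) (Ainf n).
have Amono m n : (m <= n)%N -> A n `<=` A m.
  elim: n => [|n IH]; first by rewrite leqn0 => /eqP->.
  rewrite leq_eqVlt => /predU1P[->//|/IH Anm].
  exact: subset_trans (AS n) Anm.
(* The range of [a] will be the pseudo-intersection: [n <= a n] makes it infinite, and [a m] lies in
   [A n] for all [m >= n]. *)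
have ex n : exists m, A n m /\ (n <= m)%N.
  by have [m] := (infinite_set_natP _).1 (Ainf n) n; exists m.
have [a aP] := choice ex.
exists (range a) => [|n i Pi].
  by apply/infinite_set_natP => n; exists (a n); [exists n|exact: (aP n).2].
(* The n-th family is handled in passing from [A n] to [A n.+1]. *)
apply: (@unsplit_sub_mod_finite _ (A n.+1)).
  apply: (@sub_finite_set _ _ _ _ (finite_image a (finite_II n.+1))).
  move=> _ [[m _ <-] nA]; exists m => //=.
  by rewrite ltnNge; apply/negP => nm; apply/nA/(Amono _ m nm)/(aP m).1.
by have [_ _] := gP (n, A n) (Ainf n); exact.
Qed.

Lemma maximal_separated (R : realType) (X : Type) (d : X -> X -> R)
    (d0 : forall x y, d x y = 0 <-> x = y)
    (dC : forall x y, d x y = d y x) (r : R) (r0 : 0 < r) :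
  exists E : set X,
    (forall x y, E x -> E y -> d x y < r -> x = y) /\
    forall x, exists2 y, E y & d x y < r.
Proof.
pose P := [set E : set X | forall x y, E x -> E y -> d x y < r -> x = y].
have [|E [PE Emax]] := @Zorn_bigcup _ P.
  move=> F FP Ftot x y [C FC Cx] [D FD Dy].
  have [CD|DC] := Ftot _ _ FC FD.
    exact: (FP _ FD _ _ (CD _ Cx) Dy).
  exact: (FP _ FC _ _ Cx (DC _ Dy)).
exists E; split=> // x; apply: contrapT => nx.
have xr y : E y -> ~ d x y < r by move=> Ey xy; apply: nx; exists y.
apply: (Emax (E `|` [set x])).
  split; first exact: subsetUl.
  move=> /(_ x (or_intror erefl)) Ex; apply: (xr x Ex).
  by rewrite (d0 x x).2.
move=> y z [Ey|->] [Ez|->] //; first exact: PE.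
  by rewrite dC => /(xr y Ey).
by move=> /(xr z Ez).
Qed.

(** [E n] is a maximal [1/(n+1)]-separated set: maximality gives density of the union, and
    separation lets the ball of that radius isolate each point of [E n]. *)
Lemma metrizable_sigma_discrete_dense (R : realType) (X : topologicalType) :
  metrizable R X ->
  exists2 E : nat -> set X, dense (\bigcup_n E n) &
    forall n x, E n x ->
      exists2 U, nbhs x U & forall y, E n y -> U y -> y = x.
Proof.
move=> [d [_ d0 dC _] nbhsd].
have r0 n : 0 < n.+1%:R^-1 :> R by rewrite invr_gt0.
have [E EP] := choice (fun n => maximal_separated R X d d0 dC _ (r0 n)).
exists E => [O [x Ox] Oop|n x Ex].
  have /nbhsd[e e0 eO] : nbhs x O by exact: open_nbhs_nbhs.
  have [n] := ltr_add_invr e0; rewrite add0r => ne.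
  have [y Ey xy] := (EP n).2 x.
  by exists y; split; [apply: eO; exact: lt_trans xy ne | exists n].
exists [set y | d x y < n.+1%:R^-1]; first by apply/nbhsd; exists n.+1%:R^-1.
by move=> y Ey xy; apply/esym/(EP n).1.
Qed.

Theorem corollary2p4 (R : realType) (X : topologicalType)
    (mX : metrizable R X)
    (cX : forall K : nat -> set X,
       exists2 A : set nat, infinite_set A & kuratowski_cvg K A) :
  card_lt (density X) splitting_number.
Proof.
suff nle : ~~ (splitting_number #<= density X)%card.
  apply/andP; split; first exact: card_le_total.
  by apply: contra nle => /card_eqPle[].
apply/negP => sd.
have [E Edense Edisc] := metrizable_sigma_discrete_dense _ _ mX.
(* By minimality of the density, the splitting family injects into the union of the [E n], which
   sorts its members into countably many families. *)
have /card_leP[f] := card_le_trans sd ((densityP X).2 _ Edense).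
have [[_ Ssplit] _] := splitting_numberP.
pose x (s : splitting_number) : X := val (f s).
have xinj : injective x.
  by move=> s t /val_inj; apply: inj; rewrite inE.
pose P n : set splitting_number := [set s | E n (x s)].
have [|A Ainf AP] := @countable_union_unsplit _ P val.
  move=> n; apply: (discrete_unsplit _ cX _ _ x) => s Es.
  have [U Ux Uinj] := Edisc n _ Es.
  by exists U => // t Et Ut; apply: xinj; exact: Uinj.
have [B [SB infI infD]] := Ssplit A Ainf.
have [n _ En] : (\bigcup_n E n) (x (SigSub (mem_set SB))) := set_valP _.
by have [] := AP n _ En.
Qed.
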